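(* A finite group $G$ is induced regular if and only if $G\cong H\times A$, where $A$ is an abelian group and $H$ is an induced regular $p$-group for some prime $p$.
   Context: For a finite group $G$, $C_G(x)$ denotes the centralizer of $x\in G$ and $Z(G)$ the center. The non-centralizer graph $\Upsilon_G$ is the simple graph with vertex set $G$ in which two distinct vertices $x,y$ are adjacent iff $C_G(x)\neq C_G(y)$; the induced non-centralizer graph $\Upsilon_{G\setminus Z(G)}$ is its induced subgraph on $G\setminus Z(G)$. $G$ is called induced regular if $\Upsilon_{G\setminus Z(G)}$ is a regular graph (all vertices have the same degree). *)

(* Defs.v *)
From mathcomp Require Import all_boot all_fingroup all_solvable.
Set Implicit Arguments. Unset Strict Implicit. Unset Printing Implicit Defensive.
Local Open Scope group_scope.

(* The induced non-centralizer graph of a (sub)group G viewed as a group in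
   its own right: vertex set G \ Z(G); distinct x, y adjacent iff
   C_G(x) <> C_G(y).  Degree of x in that graph: *)
Definition nc_degree (gT : finGroupType) (G : {group gT}) (x : gT) : nat :=
  #|[set y in G :\: 'Z(G) | (y != x) && ('C_G[y] != 'C_G[x])]|.

Definition induced_regular (gT : finGroupType) (G : {group gT}) : Prop :=
  forall x y, x \in G :\: 'Z(G) -> y \in G :\: 'Z(G) ->
    nc_degree G x = nc_degree G y.

(* Main.v *)
Require Import Defs.
From mathcomp Require Import all_boot all_fingroup all_solvable.
Set Implicit Arguments. Unset Strict Implicit. Unset Printing Implicit Defensive.
Local Open Scope group_scope.

(** Write Z = Z(G).  Regularity says that the classes [{y | C(y) = C(x)}], for x
    noncentral, all have the same size b.  If C(y) is maximal among the centralizers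
    of noncentral elements, then Z(C(y)) is the union of Z and the class of y.
    Comparing sizes, every prime divisor of [|G : Z|] also divides [|Z(C(y)) : Z|].

    Suppose that p is a prime divisor of [|G : Z|], but not the only one.  If C(x)
    were not maximal while all larger centralizers, such as C(y), are, then the
    products of elements of Z(C(y)) with a p-element or a p'-element of Z(C(x))
    outside Z(C(y)) would give more than b elements of the class of x.  So all
    noncentral centralizers are maximal, and it follows that they are abelian, have a
    common index n over Z and pairwise intersect in Z.  A Sylow p-subgroup P of G
    normalizes some C(z), and since G is not the union of the conjugates of C(z),
    another centralizer C(x) has its Sylow p-subgroup in P.  Modulo Z, the latter acts
    semiregularly on the Sylow q-subgroup of C(z), whence [n_p < n_q] for all prime
    divisors p != q of n, which is absurd.

    So G / Z is a p-group, and [G = O_p(G) x O_p'(G)] with O_p'(G) central.  Finally,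
    isomorphisms and the projections H x A -> H with A abelian reflect commutation,
    and such morphisms preserve induced regularity both ways. *)

(* The conjugates of H cover at most |G : H| (|H| - 1) nontrivial elements. *)
Lemma class_support_proper (gT : finGroupType) (G H : {group gT}) :
  H \proper G -> class_support H G \proper G.
Proof.
case/andP=> sHG nsGH; rewrite properE class_support_subG //=.
rewrite -indexg_gt1 in nsGH; apply: contraL nsGH => sG_HG; rewrite -leqNgt.
have: #|G^#| <= #|G : H| * #|H|.-1.
  apply: leq_trans (subset_leq_card (setSD _ sG_HG)) _; rewrite class_supportD1.
  apply: leq_trans (leq_card_cover _) _; rewrite (eq_bigr (fun=> #|H|.-1)).
    rewrite sum_nat_const card_conjugates leq_mul2r dvdn_leq ?orbT //.
    by apply: indexgS; rewrite subsetI sHG /= normD1 normG.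
  by move=> _ /imsetP[x _ ->]; rewrite cardJg (cardsD1 1 H) group1.
have cardG : #|G^#|.+1 = (#|G : H| * #|H|)%N.
  by rewrite mulnC Lagrange // [RHS](cardsD1 1) group1.
by rewrite -ltnS cardG -{1}(prednK (cardG_gt0 H)) mulnS -add1n leq_add2r.
Qed.

Section CoprimeElements.

Variables (gT : finGroupType) (pi : nat_pred).
Implicit Types (x y : gT) (Z E : {group gT}).

Lemma consttM_coprimel x y :
  pi.-elt x -> pi^'.-elt y -> commute x y -> (x * y).`_pi = x.
Proof.
by move=> pi_x pi'y cxy; rewrite consttM // (constt_p_elt pi_x) (constt1P pi'y) mulg1.
Qed.

Lemma consttM_coprimer x y :
  pi.-elt x -> pi^'.-elt y -> commute x y -> (x * y).`_pi^' = y.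
Proof.
move=> pi_x pi'y cxy; rewrite consttM // (constt_p_elt pi'y) (constt1P _) ?mul1g //.
by rewrite p_eltNK.
Qed.

Lemma coprime_commute_of_central_commg x y :
    pi.-elt x -> pi^'.-elt y -> commute x [~ x, y] -> commute y [~ x, y] ->
  commute x y.
Proof.
move=> pi_x pi'y cxc cyc; apply/commgP; rewrite -order_eq1 -dvdn1.
rewrite -(eqnP (pnat_coprime pi_x pi'y)) dvdn_gcd !order_dvdn.
by rewrite -commXg // -commgX // !expg_order comm1g commg1 eqxx.
Qed.

Lemma ltn_card_constt_notin Z E :
    abelian E ->
    (exists2 e, e \in E :\: Z & pi.-elt e) ->
    (exists2 f, f \in E :\: Z & pi^'.-elt f) ->
  #|E :\: Z| < #|[set g in E | g.`_pi \notin Z]| + #|[set g in E | g.`_pi^' \notin Z]|.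
Proof.
move=> abE [e /setDP[Ee nZe] pi_e] [f /setDP[Ef nZf] pi'f].
set X := [set _ in E | _]; set X' := [set _ in E | _].
have sEX : E :\: Z \subset X :|: X'.
  apply/subsetP=> g /setDP[Eg nZg]; rewrite !inE Eg /= -negb_and.
  by apply: contra nZg => /andP[Zg Zg']; rewrite -(consttC pi g) groupM.
apply: leq_ltn_trans (subset_leq_card sEX) _.
rewrite -cardsUI -[X in X < _]addn0 ltn_add2l card_gt0; apply/set0Pn; exists (e * f).
have cef : commute e f := centsP abE e Ee f Ef.
rewrite !inE groupM //= (consttM_coprimel pi_e pi'f cef) nZe.
by rewrite (consttM_coprimer pi_e pi'f cef).
Qed.

End CoprimeElements.

Lemma dvdn_index_p_eltP (gT : finGroupType) (Z E : {group gT}) (p : nat) :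
    prime p -> Z <| E ->
  reflect (exists2 u, u \in E :\: Z & p.-elt u) (p %| #|E : Z|).
Proof.
move=> pr_p /andP[sZE nZE]; rewrite -card_quotient //.
apply: (iffP idP) => [/(Cauchy pr_p)[_ /morphimP[u Nu Eu ->] ou] | [u /setDP[Eu nZu] pu]].
  exists u.`_p; last exact: p_elt_constt.
  apply/setDP; split; [exact: groupX | apply: contraL (prime_gt1 pr_p) => Zu].
  have pcu : p.-elt (coset Z u) by rewrite /p_elt ou pnat_id.
  have cu1 : coset Z u = 1 by rewrite -(constt_p_elt pcu) -morph_constt //= coset_id.
  by rewrite -ou /= cu1 order1.
have Nu := subsetP nZE u Eu.
apply: dvdn_trans (order_dvdG (mem_quotient Z Eu)).
have [n ou] := p_natP (morph_p_elt (coset_morphism Z) Nu pu).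
case: n ou => [/eqP | n ->]; last exact: dvdn_exp.
by rewrite order_eq1 => /eqP/(coset_idr Nu)/(negP nZu).
Qed.

Lemma card_pcore_quotient (gT : finGroupType) (pi : nat_pred) (G H : {group gT}) :
  nilpotent G -> G \subset 'N(H) -> #|'O_pi(G) / H| = (#|G : H|`_pi)%N.
Proof.
move=> nilG nHG; have hallO := nilpotent_pcore_Hall pi nilG.
have nHO := subset_trans (pHall_sub hallO) nHG.
by rewrite (card_Hall (quotient_pHall nHO hallO)) card_quotient.
Qed.

Lemma pcoreC_sub_center (gT : finGroupType) (pi : nat_pred) (G : {group gT}) :
  pi.-group (G / 'Z(G)) -> 'O_pi^'(G) \subset 'Z(G).
Proof.
move=> piGZ; rewrite -quotient_sub1; last first.
  exact: subset_trans (pcore_sub _ _) (gFnorm _ G).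
have tiO : coprime #|'O_pi^'(G) / 'Z(G)| #|G / 'Z(G)|.
  rewrite coprime_sym (pnat_coprime piGZ) //.
  exact: quotient_pgroup (pcore_pgroup _ _).
by rewrite -(coprime_TIg tiO) subsetI subxx quotientS ?pcore_sub.
Qed.

Definition cent_class (gT : finGroupType) (G : {group gT}) (x : gT) : {set gT} :=
  [set y in G | 'C_G[y] == 'C_G[x]].

Section SubcentOne.

Variables (gT : finGroupType) (G : {group gT}).
Implicit Types (x y z : gT) (pi : nat_pred) (P : {group gT}).

Lemma subcent1_center x : x \in 'Z(G) -> 'C_G[x] = G.
Proof.
case/centerP=> _ cGx; apply/setIidPl/subsetP=> y Gy.
by apply/cent1P/commute_sym/cGx.
Qed.

Lemma mem_centerE x : x \in G -> (x \in 'Z(G)) = (G \subset 'C_G[x]).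
Proof.
move=> Gx; apply/idP/idP=> [/subcent1_center-> // | /subsetP sGC].
by apply/centerP; split=> // y /sGC/subcent1P[].
Qed.

Lemma center_subcent1_sub x : 'Z('C_G[x]) \subset G.
Proof. exact: subset_trans (center_sub _) (subcent1_sub _ _). Qed.

Lemma subcent1_sub_center x y : y \in 'Z('C_G[x]) -> 'C_G[x] \subset 'C_G[y].
Proof.
case/centerP=> _ cCy; apply/subsetP=> z Cz; have [Gz _] := setIP Cz.
by apply/subcent1P; split=> //; apply: cCy.
Qed.

Lemma mem_center_subcent1 x y : x \in G ->
  (y \in 'Z('C_G[x])) = (y \in G) && ('C_G[x] \subset 'C_G[y]).
Proof.
move=> Gx; apply/idP/andP=> [Zy | [Gy /subsetP sC]].
  by rewrite (subsetP (center_subcent1_sub x)) // subcent1_sub_center.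
apply/centerP; split=> [|z /sC/subcent1P[] //].
by apply: subcent1C => //; apply/sC/subcent1_id.
Qed.

Lemma mem_center_subcent1_id x : x \in G -> x \in 'Z('C_G[x]).
Proof. by move=> Gx; rewrite mem_center_subcent1 // Gx subxx. Qed.

Lemma center_subcent1S x y : x \in G -> y \in G -> 'C_G[x] \subset 'C_G[y] ->
  'Z('C_G[y]) \subset 'Z('C_G[x]).
Proof.
move=> Gx Gy sC; apply/subsetP=> z; rewrite !mem_center_subcent1 //.
by case/andP=> -> /(subset_trans sC).
Qed.

Lemma center_sub_center_subcent1 x : x \in G -> 'Z(G) \subset 'Z('C_G[x]).
Proof.
move=> Gx; apply/subsetP=> z Zz; rewrite mem_center_subcent1 //.
by rewrite (subcent1_center Zz) subcent1_sub (subsetP (center_sub G)).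
Qed.

Lemma center_sub_subcent1 x : x \in G -> 'Z(G) \subset 'C_G[x].
Proof. by move/center_sub_center_subcent1/subset_trans; apply; apply: center_sub. Qed.

Lemma center_normal_center_subcent1 x : x \in G -> 'Z(G) <| 'Z('C_G[x]).
Proof.
move=> Gx; apply: normalS (center_sub_center_subcent1 Gx) _ (center_normal G).
exact: center_subcent1_sub.
Qed.

Lemma subcent1M_sub x y : 'C_G[x] :&: 'C_G[y] \subset 'C_G[x * y].
Proof.
apply/subsetP=> z /setIP[/subcent1P[Gz cxz] /subcent1P[_ cyz]].
by apply/subcent1P; split=> //; apply/commute_sym/commuteM; apply: commute_sym.
Qed.

Lemma subcent1_constt x pi : 'C_G[x] \subset 'C_G[x.`_pi].
Proof.
apply/setIS/subsetP=> z /cent1P czx; apply/cent1P.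
by have /cycleP[i ->] := cycle_constt pi x; apply: commuteX.
Qed.

Lemma subcent1_mulZ x z : z \in 'Z(G) -> 'C_G[x * z] = 'C_G[x].
Proof.
have subM y t : t \in 'Z(G) -> 'C_G[y] \subset 'C_G[y * t].
  move=> Zt; apply: subset_trans (subcent1M_sub _ _).
  by rewrite (subcent1_center Zt) subsetI subxx subcent1_sub.
by move=> Zz; apply/eqP; rewrite eqEsubset subM // -{2}(mulgK z x) subM ?groupV.
Qed.

Lemma subcent1J x y : y \in G -> 'C_G[x ^ y] = 'C_G[x] :^ y.
Proof. by move=> Gy; rewrite conjIg conjGid // cent1J. Qed.

Lemma subcent1_proper x : x \in G :\: 'Z(G) -> 'C_G[x] \proper G.
Proof. by case/setDP=> Gx nZx; rewrite properE subcent1_sub -mem_centerE. Qed.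

Lemma cent_class_noncentral x :
  x \in G :\: 'Z(G) -> cent_class G x \subset G :\: 'Z(G).
Proof.
case/setDP=> Gx nZx; apply/subsetP=> y /setIdP[Gy /eqP eqC].
by rewrite inE Gy andbT mem_centerE // eqC -mem_centerE.
Qed.

Lemma nc_degree_cent_class x : x \in G :\: 'Z(G) ->
  (nc_degree G x + #|cent_class G x|)%N = #|G :\: 'Z(G)|.
Proof.
move=> nZx; rewrite -(cardsID (cent_class G x) (G :\: 'Z(G))) addnC.
rewrite (setIidPr (cent_class_noncentral nZx)); congr (_ + _)%N.
apply: eq_card => y; rewrite !inE; case: (y \in G); rewrite ?andbF //= !andbT.
by rewrite andbC; case: eqVneq => [->|]; rewrite ?eqxx.
Qed.

Lemma induced_regularP :
  induced_regular G <->
  {in G :\: 'Z(G) &, forall x y, #|cent_class G x| = #|cent_class G y|}.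
Proof.
have degE x y : x \in G :\: 'Z(G) -> y \in G :\: 'Z(G) ->
    (nc_degree G x + #|cent_class G x| = nc_degree G y + #|cent_class G y|)%N.
  by move=> nZx nZy; rewrite !nc_degree_cent_class.
by split=> reg x y nZx nZy; have:= degE x y nZx nZy; rewrite (reg x y) //;
  [apply: addnI | apply: addIn].
Qed.

(* C(z) is normalized by P as soon as z is central in P modulo Z(G). *)
Lemma nilpotent_norm_subcent1 P :
    P \subset G -> nilpotent P -> ~~ (P \subset 'Z(G)) ->
  exists2 z, z \in G :\: 'Z(G) & P \subset 'N('C_G[z]).
Proof.
move=> sPG nilP nsPZ.
have nZP : P \subset 'N('Z(G)) := subset_trans sPG (gFnorm _ G).
have ntZ : 'Z(P / 'Z(G)) != 1.
  by rewrite center_nil_eq1 ?quotient_nil // -subG1 quotient_sub1.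
have [_ /centerP[/morphimP[z _ Pz ->] cPz] ntz] := trivgPn _ ntZ.
exists z.
  rewrite inE (subsetP sPG) // andbT; apply: contra ntz => Zz.
  by apply/eqP/coset_id.
apply/subsetP=> y Py; have [Gy Gz] := (subsetP sPG y Py, subsetP sPG z Pz).
have Zzy : [~ z, y] \in 'Z(G).
  apply: coset_idr; first by rewrite groupR ?(subsetP nZP).
  by rewrite morphR ?(subsetP nZP) //; apply/eqP/commgP/cPz/mem_quotient.
by rewrite inE -subcent1J // conjg_mulR subcent1_mulZ.
Qed.

End SubcentOne.

Section ReflectCommute.

Variables (aT rT : finGroupType) (D G : {group aT}) (f : {morphism D >-> rT}).
Hypothesis sGD : G \subset D.

Lemma card_setI_morphpre (B : {set rT}) :
  B \subset f @* G -> #|G :&: f @*^-1 B| = (#|B| * #|'ker_G f|)%N.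
Proof.
move=> sBfG; rewrite -sum1_card (partition_big f (mem B)) /=; last first.
  by move=> x /setIP[_ /morphpreP[]].
rewrite -sum_nat_const; apply: eq_bigr => y By; rewrite sum1_card.
have /morphimP[x Dx Gx defy] := subsetP sBfG y By.
rewrite -(card_rcoset ('ker_G f) x); apply: eq_card => z; rewrite [LHS]inE.
apply/andP/rcosetP=> [[/setIP[Gz _] /eqP fz] | [u /setIP[Gu ker_u] ->]].
  have Dz := subsetP sGD z Gz; exists (z * x^-1); last by rewrite mulgKV.
  by rewrite inE groupM ?groupV //= -mem_rcoset; apply/rcoset_kerP; rewrite // fz.
have Du := subsetP sGD u Gu.
have fux : f (u * x) = y by rewrite morphM // (mker ker_u) mul1g.
by rewrite fux eqxx !inE groupM //= groupM //= fux.
Qed.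

Hypothesis f_reflects : {in G &, forall x y, commute (f x) (f y) -> commute x y}.

Lemma mem_morphim_subcent1 x y : x \in G -> y \in G ->
  (f y \in 'C_(f @* G)[f x]) = (y \in 'C_G[x]).
Proof.
move=> Gx Gy; have [Dx Dy] := (subsetP sGD x Gx, subsetP sGD y Gy).
apply/subcent1P/subcent1P=> [[_ cxy] | [_ cxy]]; split=> //.
- exact: f_reflects.
- exact: mem_morphim.
by rewrite /commute -!morphM // cxy.
Qed.

Lemma mem_morphim_center x : x \in G -> (f x \in 'Z(f @* G)) = (x \in 'Z(G)).
Proof.
move=> Gx; have fGx : f x \in f @* G by rewrite mem_morphim ?(subsetP sGD).
rewrite !mem_centerE //; apply/subsetP/subsetP=> sC y.
  move=> Gy; rewrite -mem_morphim_subcent1 //.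
  by apply: sC; rewrite mem_morphim ?(subsetP sGD).
by case/morphimP=> z _ Gz ->; rewrite mem_morphim_subcent1 // sC.
Qed.

Lemma cent_class_morphpre x : x \in G ->
  cent_class G x = G :&: f @*^-1 (cent_class (f @* G) (f x)).
Proof.
move=> Gx; apply/setP=> y; rewrite !inE; apply: andb_id2l => Gy.
rewrite (subsetP sGD) ?mem_morphim ?(subsetP sGD) //=.
apply/eqP/eqP=> eqC; apply/setP=> z.
  have [/morphimP[t _ Gt ->] | nGz] := boolP (z \in f @* G); last first.
    by rewrite !in_setI (negPf nGz).
  by rewrite !mem_morphim_subcent1 // eqC.
have [Gz | nGz] := boolP (z \in G); last by rewrite !in_setI (negPf nGz).
by rewrite -!mem_morphim_subcent1 // eqC.
Qed.

Lemma morphim_induced_regular : induced_regular G <-> induced_regular (f @* G).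
Proof.
have cardE x : x \in G ->
    #|cent_class G x| = (#|cent_class (f @* G) (f x)| * #|'ker_G f|)%N.
  move=> Gx; rewrite cent_class_morphpre // card_setI_morphpre //.
  by apply/subsetP=> y /setIdP[].
have noncentral_f x : x \in G -> (f x \in f @* G :\: 'Z(f @* G)) = (x \in G :\: 'Z(G)).
  by move=> Gx; rewrite !in_setD mem_morphim_center ?mem_morphim ?(subsetP sGD) ?Gx.
split=> /induced_regularP reg; apply/induced_regularP=> x y nZx nZy.
  have [[/morphimP[u _ Gu defx] _] [/morphimP[v _ Gv defy] _]] := (setDP nZx, setDP nZy).
  move: nZx nZy; rewrite defx defy !noncentral_f // => nZu nZv.
  by apply/eqP; rewrite -(eqn_pmul2r (cardG_gt0 ('ker_G f))) -!cardE // (reg u v).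
have [[Gx _] [Gy _]] := (setDP nZx, setDP nZy).
by rewrite !cardE // (reg (f x) (f y)) ?noncentral_f.
Qed.

End ReflectCommute.

Lemma isog_induced_regular (aT rT : finGroupType) (G : {group aT}) (K : {group rT}) :
  G \isog K -> (induced_regular G <-> induced_regular K).
Proof.
case/isogP=> f injf defK; have ->: K = (f @* G)%G by apply/val_inj.
apply: morphim_induced_regular => // x y Gx Gy cfxy.
by apply: (injmP injf); rewrite ?groupM // !morphM.
Qed.

Lemma setX_abelian_induced_regular (hT aT : finGroupType)
    (H : {group hT}) (A : {group aT}) :
  abelian A -> (induced_regular (setX H A) <-> induced_regular H).
Proof.
move=> abA; pose fst_mor := [morphism of fun u : hT * aT => u.1].
have reg_fst : induced_regular (setX H A) <-> induced_regular (fst_mor @* setX H A).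
  apply: morphim_induced_regular; rewrite ?subsetT //.
  move=> [h a] [k b] /setXP[_ Aa] /setXP[_ Ab] chk; congr (_, _) => //=.
  exact: (centsP abA).
have defH : H = (fst_mor @* setX H A)%G by apply/val_inj; rewrite /= morphim_fstX.
by rewrite [in X in _ <-> X]defH.
Qed.

Definition maximal_subcent1 (gT : finGroupType) (G : {group gT}) (y : gT) : Prop :=
  y \in G :\: 'Z(G) /\
  forall w, w \in G :\: 'Z(G) -> 'C_G[y] \subset 'C_G[w] -> 'C_G[w] = 'C_G[y].

Definition maximal_centers_have (gT : finGroupType) (G : {group gT})
    (pi : nat_pred) : Prop :=
  forall y, maximal_subcent1 G y ->
  exists2 e, e \in 'Z('C_G[y]) :\: 'Z(G) & pi.-elt e.

Section MaximalSubcent.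

Variables (gT : finGroupType) (G : {group gT}).
Implicit Types (x y u g : gT) (pi : nat_pred).

Lemma exists_maximal_subcent1 x : x \in G :\: 'Z(G) ->
  exists2 y, maximal_subcent1 G y & 'C_G[x] \subset 'C_G[y].
Proof.
move=> nZx; pose above y := (y \in G :\: 'Z(G)) && ('C_G[x] \subset 'C_G[y]).
have above_x : above x by rewrite /above nZx /=.
case: (arg_maxnP (fun y => #|'C_G[y]|) above_x) => y /andP[nZy sCxy] max_y.
exists y => //; split=> // w nZw sCyw; apply/eqP; rewrite eq_sym eqEcard sCyw.
by apply: max_y; rewrite /above nZw (subset_trans sCxy).
Qed.

Lemma maximal_subcent1_eq y g : maximal_subcent1 G y ->
  g \in 'Z('C_G[y]) -> g \notin 'Z(G) -> 'C_G[g] = 'C_G[y].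
Proof.
case=> _ max_y Zg nZg; apply: max_y; last exact: subcent1_sub_center.
by rewrite inE nZg (subsetP (center_subcent1_sub G y)).
Qed.

Lemma cent_class_maximal y : maximal_subcent1 G y ->
  cent_class G y = 'Z('C_G[y]) :\: 'Z(G).
Proof.
move=> max_y; have [nZy _] := max_y; have [Gy _] := setDP nZy.
apply/setP=> g; apply/idP/setDP=> [cl_g | [Zg nZg]]; last first.
  by rewrite inE (maximal_subcent1_eq max_y) // eqxx (subsetP (center_subcent1_sub G y)).
have /setDP[_ nZg] := subsetP (cent_class_noncentral nZy) g cl_g.
by have /setIdP[Gg /eqP eqC] := cl_g; rewrite mem_center_subcent1 // Gg eqC subxx.
Qed.

Lemma card_center_maximal y : maximal_subcent1 G y ->
  #|'Z('C_G[y])| = (#|cent_class G y| + #|'Z(G)|)%N.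
Proof.
move=> max_y; have [/setDP[Gy _] _] := max_y; rewrite (cent_class_maximal max_y) addnC.
by rewrite -{1}(setIidPr (center_sub_center_subcent1 Gy)) cardsID.
Qed.

Section AllMaximal.

Hypothesis all_maximal : forall x, x \in G :\: 'Z(G) -> maximal_subcent1 G x.

(* For a noncentral f in Z(C(x)) of order prime to pi, the centralizers of f and of
   (u_pi) f are comparable, hence both equal to C(x). *)
Lemma constt_mem_center_subcent1 pi x u : maximal_centers_have G pi^' ->
  x \in G :\: 'Z(G) -> u \in 'C_G[x] -> u.`_pi \in 'Z('C_G[x]).
Proof.
move=> have_pi' nZx Cu; have [Gx _] := setDP nZx; have max_x := all_maximal nZx.
have [f /setDP[Zf nZf] pi'f] := have_pi' x max_x.
have Gf := subsetP (center_subcent1_sub G x) f Zf.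
have Cv : u.`_pi \in 'C_G[x] by apply: groupX.
move: (u.`_pi) (p_elt_constt pi u) Cv => v pi_v Cv; have [Gv _] := setIP Cv.
have cvf : commute v f by case/centerP: Zf => _ /(_ v Cv)/commute_sym.
have vf_pi := consttM_coprimel pi_v pi'f cvf.
have vf_pi' := consttM_coprimer pi_v pi'f cvf.
have nZvf : v * f \notin 'Z(G).
  by apply: contra nZf => Zvf; rewrite -vf_pi'; apply: groupX.
have [_ max_vf] : maximal_subcent1 G (v * f).
  by apply: all_maximal; rewrite inE nZvf groupM.
have eqCf : 'C_G[f] = 'C_G[v * f].
  by apply: max_vf; [rewrite inE nZf | rewrite -{2}vf_pi' subcent1_constt].
rewrite mem_center_subcent1 // Gv /= -(maximal_subcent1_eq max_x Zf nZf).
by rewrite eqCf -{2}vf_pi subcent1_constt.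
Qed.

Lemma center_subcent1_eq pi x :
    maximal_centers_have G pi -> maximal_centers_have G pi^' ->
  x \in G :\: 'Z(G) -> 'Z('C_G[x]) = 'C_G[x].
Proof.
move=> have_pi have_pi' nZx; apply/eqP; rewrite eqEsubset center_sub.
apply/subsetP=> u Cu; rewrite -(consttC pi u) groupM //.
  exact: constt_mem_center_subcent1.
apply: constt_mem_center_subcent1 => // y /have_pi[e Ze pi_e].
by exists e; rewrite ?p_eltNK.
Qed.

End AllMaximal.

End MaximalSubcent.

Section EqualClasses.

Variables (gT : finGroupType) (G : {group gT}).
Hypothesis eq_card_class :
  {in G :\: 'Z(G) &, forall x y, #|cent_class G x| = #|cent_class G y|}.
Implicit Types (x y u w e f g : gT) (pi : nat_pred).

Lemma eq_card_center_maximal y1 y2 : maximal_subcent1 G y1 -> maximal_subcent1 G y2 ->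
  #|'Z('C_G[y1])| = #|'Z('C_G[y2])|.
Proof.
move=> max_y1 max_y2; have [[nZy1 _] [nZy2 _]] := (max_y1, max_y2).
by rewrite !card_center_maximal // (eq_card_class nZy1 nZy2).
Qed.

(* If Z(C(y)) had no noncentral q-element, then u Z(C(y)) would lie in the class of
   any q-element u with C(u) contained in C(y), and be too large. *)
Lemma maximal_centers_have_prime q :
  prime q -> q %| #|G : 'Z(G)| -> maximal_centers_have G q.
Proof.
move=> pr_q /(dvdn_index_p_eltP pr_q (center_normal G))[u nZu qu] y0 max_y0.
have [y max_y sCuy] := exists_maximal_subcent1 nZu; have [Gu _] := setDP nZu.
have [[nZy0 _] [nZy _]] := (max_y0, max_y).
have [[Gy0 _] [Gy _]] := (setDP nZy0, setDP nZy).
apply/(dvdn_index_p_eltP pr_q (center_normal_center_subcent1 Gy0)).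
have -> : #|'Z('C_G[y0]) : 'Z(G)| = #|'Z('C_G[y]) : 'Z(G)|.
  by rewrite -!divgS ?center_sub_center_subcent1 // (eq_card_center_maximal max_y0 max_y).
apply/(dvdn_index_p_eltP pr_q (center_normal_center_subcent1 Gy)).
have [/exists_inP // | /exists_inPn no_q] :=
  boolP [exists g in 'Z('C_G[y]) :\: 'Z(G), q.-elt g].
have Zq g : g \in 'Z('C_G[y]) -> g.`_q \in 'Z(G).
  move=> Zg; apply: contraT => nZgq; have := no_q g.`_q.
  by rewrite p_elt_constt in_setD nZgq => /(_ (groupX _ Zg)).
have sZyu := center_subcent1S Gu Gy sCuy.
have: #|u *: 'Z('C_G[y])| <= #|cent_class G u|.
  apply/subset_leq_card/subsetP=> _ /lcosetP[g Zg ->].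
  have Zug := subsetP sZyu g Zg.
  have Gg := subsetP (center_subcent1_sub G y) g Zg.
  rewrite inE groupM //= eqEsubset; apply/andP; split.
    have cug : commute u g.
      by case/centerP: Zug => _ /(_ u (subcent1_id Gu))/commute_sym.
    rewrite -(subcent1_mulZ u (Zq g Zg)) -{2}(constt_p_elt qu) -consttM //.
    exact: subcent1_constt.
  apply: subset_trans (subcent1M_sub _ _ _).
  by rewrite subsetI subxx subcent1_sub_center.
rewrite card_lcoset card_center_maximal // (eq_card_class nZy nZu).
by rewrite -{2}[#|cent_class G u|]addn0 leq_add2l leqNgt cardG_gt0.
Qed.

Section BelowMaximal.

Variables x y : gT.
Hypotheses (nZx : x \in G :\: 'Z(G)) (nZy : y \in G :\: 'Z(G)).
Hypothesis maximal_above :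
  forall w, w \in G :\: 'Z(G) -> 'C_G[x] \proper 'C_G[w] -> maximal_subcent1 G w.
Hypothesis ltCxy : 'C_G[x] \proper 'C_G[y].

Let Gx : x \in G. Proof. by case/setDP: nZx. Qed.
Let Gy : y \in G. Proof. by case/setDP: nZy. Qed.
Let max_y : maximal_subcent1 G y. Proof. exact: maximal_above. Qed.

Let sZyx : 'Z('C_G[y]) \subset 'Z('C_G[x]).
Proof. exact: center_subcent1S (proper_sub ltCxy). Qed.

Lemma center_subcent1_maximal w :
    w \in 'Z('C_G[x]) -> w \notin 'Z(G) -> 'C_G[w] != 'C_G[x] ->
  maximal_subcent1 G w.
Proof.
move=> Zw nZw neqC; have Gw := subsetP (center_subcent1_sub G x) w Zw.
apply: maximal_above; first exact/setDP.
by rewrite properEneq eq_sym neqC subcent1_sub_center.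
Qed.

Lemma subcent1_eq_below pi g : g \in 'Z('C_G[x]) :\: 'Z('C_G[y]) ->
  g.`_pi \in 'Z('C_G[y]) :\: 'Z(G) -> 'C_G[g] = 'C_G[x].
Proof.
case/setDP=> Zxg nZyg /setDP[Zy_gpi nZ_gpi]; apply: contraNeq nZyg => neqC.
have nZg : g \notin 'Z(G) by apply: contra nZ_gpi; apply: groupX.
have [_ max_g] := center_subcent1_maximal Zxg nZg neqC.
have Ggpi := subsetP (center_subcent1_sub G y) _ Zy_gpi.
rewrite mem_center_subcent1 // (subsetP (center_subcent1_sub G x)) //=.
rewrite -(maximal_subcent1_eq max_y Zy_gpi nZ_gpi) (max_g g.`_pi) ?subcent1_constt //.
by rewrite inE nZ_gpi.
Qed.

(* Otherwise Z(C(x)) would be the union of Z(G) and the classes of x and y, which is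
   less than twice as large as its proper subgroup Z(C(y)). *)
Lemma exists_p_elt_below pi : maximal_centers_have G pi ->
  exists2 e, e \in 'Z('C_G[x]) :\: 'Z('C_G[y]) & pi.-elt e.
Proof.
move=> have_pi.
have [/exists_inP // | /exists_inPn no_pi] :=
  boolP [exists e in 'Z('C_G[x]) :\: 'Z('C_G[y]), pi.-elt e].
have sZx : 'Z('C_G[x]) :\: 'Z(G) \subset cent_class G x :|: cent_class G y.
  apply/subsetP=> w /setDP[Zw nZw]; have Gw := subsetP (center_subcent1_sub G x) w Zw.
  rewrite !inE Gw /=; case: eqVneq => //= neqC.
  have max_w := center_subcent1_maximal Zw nZw neqC.
  have [v /setDP[Zwv nZv] pi_v] := have_pi w max_w.
  have Zxv := subsetP (center_subcent1S Gx Gw (subcent1_sub_center Zw)) v Zwv.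
  rewrite -(maximal_subcent1_eq max_w Zwv nZv) (maximal_subcent1_eq max_y) //.
  by apply: contraLR pi_v => nZyv; apply: no_pi; rewrite inE nZyv.
have gt1 : 1 < #|'Z('C_G[x]) : 'Z('C_G[y])|.
  rewrite indexg_gt1; apply: contra (proper_subn ltCxy) => /subsetP-sZxy.
  by apply: subcent1_sub_center; apply: sZxy; apply: mem_center_subcent1_id.
have := leq_trans (subset_leq_card sZx) (leq_card_setU _ _).
rewrite cardsD (setIidPr (center_sub_center_subcent1 Gx)) leq_subLR leqNgt => /negP[].
rewrite -(Lagrange sZyx); apply: leq_trans (leq_mul (leqnn _) gt1).
rewrite card_center_maximal // (eq_card_class nZx nZy) muln2 -addnn addnACA addnC.
by rewrite ltn_add2l -[X in X < _]addn0 ltn_add2l.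
Qed.

Lemma mul_mem_cent_class_below pi u g :
    u \in 'Z('C_G[x]) :\: 'Z('C_G[y]) -> pi^'.-elt u ->
    g \in 'Z('C_G[y]) -> g.`_pi \notin 'Z(G) ->
  u * g \in cent_class G x.
Proof.
case/setDP=> Zxu nZyu pi'u Zyg nZg; have Zxg := subsetP sZyx g Zyg.
have cug : commute u g := centsP (center_abelian _) u Zxu g Zxg.
rewrite inE (subsetP (center_subcent1_sub G x)) ?groupM //; apply/eqP.
apply: (@subcent1_eq_below pi); first by rewrite inE groupMr // nZyu groupM.
by rewrite consttM // (constt1P pi'u) mul1g inE nZg groupX.
Qed.

Lemma no_coprime_elts_below pi e f :
    maximal_centers_have G pi -> maximal_centers_have G pi^' ->
    e \in 'Z('C_G[x]) :\: 'Z('C_G[y]) -> f \in 'Z('C_G[x]) :\: 'Z('C_G[y]) ->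
  pi.-elt e -> ~~ pi^'.-elt f.
Proof.
move=> have_pi have_pi' De Df pi_e; apply/negP=> pi'f.
pose X := [set g in 'Z('C_G[y]) | g.`_pi \notin 'Z(G)].
pose X' := [set g in 'Z('C_G[y]) | g.`_pi^' \notin 'Z(G)].
have s_class : f *: X :|: e *: X' \subset cent_class G x.
  apply/subsetP=> _ /setUP[] /lcosetP[g /setIdP[Zyg nZg] ->].
    exact: mul_mem_cent_class_below nZg.
  by apply: mul_mem_cent_class_below nZg; rewrite ?p_eltNK.
have ti_cosets : [disjoint f *: X & e *: X'].
  rewrite -setI_eq0; apply: contraT => /set0Pn[_ /setIP[/lcosetP[g + ->] /lcosetP[h]]].
  move=> /setIdP[Zyg _] /setIdP[Zyh _] fg_eh.
  have [[Zxe _] [Zxf nZyf]] := (setDP De, setDP Df).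
  have cef : commute e^-1 f by apply: (centsP (center_abelian 'C_G[x])); rewrite ?groupV.
  case/negP: nZyf; rewrite -(consttM_coprimer _ pi'f cef) ?p_eltV //; apply: groupX.
  suff -> : e^-1 * f = h * g^-1 by rewrite groupM ?groupV.
  by rewrite -(mulgK g f) fg_eh !mulgA mulVg mul1g.
have := subset_leq_card s_class.
rewrite cardsU (disjoint_setI0 ti_cosets) cards0 subn0 !card_lcoset leqNgt => /negP[].
rewrite (eq_card_class nZx nZy) cent_class_maximal //.
exact: ltn_card_constt_notin (center_abelian _) (have_pi y max_y) (have_pi' y max_y).
Qed.

End BelowMaximal.

Lemma all_maximal_subcent1 pi x :
    maximal_centers_have G pi -> maximal_centers_have G pi^' ->
  x \in G :\: 'Z(G) -> maximal_subcent1 G x.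
Proof.
move=> have_pi have_pi'; have [n] := ubnP (#|G| - #|'C_G[x]|).
elim: n x => // n IHn x le_n nZx.
have maximal_above w :
    w \in G :\: 'Z(G) -> 'C_G[x] \proper 'C_G[w] -> maximal_subcent1 G w.
  move=> nZw ltC; apply: IHn => //; apply: leq_trans (le_n : _ <= n).
  by rewrite ltn_sub2l ?proper_card // (proper_sub_trans ltC) ?subcent1_sub.
split=> // y nZy sCxy; apply/eqP; rewrite eq_sym; apply: contraT => neqC.
have ltCxy : 'C_G[x] \proper 'C_G[y] by rewrite properEneq neqC.
have [e De pi_e] := exists_p_elt_below nZx nZy maximal_above ltCxy have_pi.
have [f Df pi'f] := exists_p_elt_below nZx nZy maximal_above ltCxy have_pi'.
have := no_coprime_elts_below nZx nZy maximal_above ltCxy have_pi have_pi' De Df pi_e.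
by rewrite pi'f.
Qed.

End EqualClasses.

Lemma exists_pcore_norm_subcent1 (gT : finGroupType) (G : {group gT}) (p : nat) :
    prime p -> p %| #|G : 'Z(G)| ->
  exists z x, [/\ z \in G :\: 'Z(G), x \in G :\: 'Z(G), 'C_G[x] != 'C_G[z]
                & 'O_p('C_G[x]) \subset 'N('C_G[z])].
Proof.
move=> pr_p p_dvd; have nZG : G \subset 'N('Z(G)) := gFnorm _ G.
have [P sylP] := Sylow_exists p G; have [sPG pP] := (pHall_sub sylP, pHall_pgroup sylP).
have nsPZ : ~~ (P \subset 'Z(G)).
  apply: contraL p_dvd => sPZ; rewrite -p'natE // -card_quotient //.
  have := quotient_pHall (subset_trans sPG nZG) sylP.
  by rewrite (quotientS1 sPZ) /pHall indexg1 => /and3P[].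
have [z nZz nCzP] := nilpotent_norm_subcent1 sPG (pgroup_nil pP) nsPZ.
have [Gz _] := setDP nZz.
have [_ [g Gg nzg]] := properP (class_support_proper (subcent1_proper nZz)).
have sOgG : 'O_p('C_G[g]) \subset G := subset_trans (pcore_sub _ _) (subcent1_sub g G).
have [h Gh sOP] := Sylow_Jsub sylP sOgG (pcore_pgroup _ _).
have nCz_gh : g ^ h \notin 'C_G[z].
  by apply: contra nzg => /memJ_class_support/(_ (groupVr Gh)); rewrite conjgK.
have Ggh : g ^ h \in G by rewrite groupJ.
exists z, (g ^ h); split=> //.
- rewrite inE Ggh andbT; apply: contra nCz_gh.
  exact: subsetP (center_sub_subcent1 Gz) _.
- by apply: contraNneq nCz_gh => <-; apply: subcent1_id.
by apply: subset_trans nCzP; rewrite subcent1J // pcoreJ.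
Qed.

Section AbelianCentralizers.

Variables (gT : finGroupType) (G : {group gT}).
Hypothesis abelian_subcent1 : forall x, x \in G :\: 'Z(G) -> abelian 'C_G[x].
Implicit Types (x z m : gT) (p q : nat).

Lemma abelian_subcent1_eq x m : x \in G :\: 'Z(G) -> m \in G :\: 'Z(G) ->
  m \in 'C_G[x] -> 'C_G[m] = 'C_G[x].
Proof.
have sub u v : u \in G :\: 'Z(G) -> v \in 'C_G[u] -> 'C_G[u] \subset 'C_G[v].
  move=> nZu Cv; apply: subcent1_sub_center.
  by rewrite (center_idP (abelian_subcent1 nZu)).
move=> nZx nZm Cm; have [[Gx _] [Gm _]] := (setDP nZx, setDP nZm).
by apply/eqP; rewrite eqEsubset !sub // subcent1C.
Qed.

Lemma abelian_subcent1_TI x z : x \in G :\: 'Z(G) -> z \in G :\: 'Z(G) ->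
  'C_G[x] != 'C_G[z] -> 'C_G[x] :&: 'C_G[z] \subset 'Z(G).
Proof.
move=> nZx nZz neqC; apply/subsetP=> m /setIP[Cxm Czm].
apply: contraR neqC => nZm; have nZm' : m \in G :\: 'Z(G).
  by rewrite inE nZm; case/setIP: Cxm.
by rewrite -(abelian_subcent1_eq nZx nZm' Cxm) (abelian_subcent1_eq nZz nZm' Czm).
Qed.

(* Modulo Z(G), the p-part of C(x) acts semiregularly on the q-part of C(z). *)
Lemma part_index_dvd_pred p q x z : p != q ->
    x \in G :\: 'Z(G) -> z \in G :\: 'Z(G) -> 'C_G[x] != 'C_G[z] ->
    'O_p('C_G[x]) \subset 'N('C_G[z]) ->
  #|'C_G[x] : 'Z(G)|`_p %| (#|'C_G[z] : 'Z(G)|`_q).-1.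
Proof.
move=> neq_pq nZx nZz neqC nCzO.
have nZC g : 'C_G[g] \subset 'N('Z(G)).
  exact: subset_trans (subcent1_sub g G) (gFnorm _ G).
rewrite -!(card_pcore_quotient _ (abelian_nil (abelian_subcent1 _)) (nZC _)) //.
have nOqOp : 'O_p('C_G[x]) \subset 'N('O_q('C_G[z])).
  exact: char_norm_trans (pcore_char q _) nCzO.
apply: regular_norm_dvd_pred; first exact: quotient_norms.
move=> rZ /setD1P[ntr /morphimP[r Nr Or defr]].
apply/trivgP/subsetP=> _ /setIP[/morphimP[m Nm Om ->] /cent1P cmr].
have [Cxr Czm] := (subsetP (pcore_sub _ _) r Or, subsetP (pcore_sub _ _) m Om).
have [[Gr _] [Gm _]] := (setIP Cxr, setIP Czm).
have Z_mr : [~ m, r] \in 'Z(G).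
  apply: coset_idr; first by rewrite groupR.
  by rewrite morphR //=; apply/eqP/commgP; rewrite -defr.
have cGmr g : g \in G -> commute g [~ m, r].
  by case/centerP: Z_mr => _ cG Gg; apply/commute_sym/cG.
have cmr' : commute m r.
  have q_m : q.-elt m := mem_p_elt (pcore_pgroup _ _) Om.
  apply: coprime_commute_of_central_commg q_m _ (cGmr m Gm) (cGmr r Gr).
  by apply: sub_p_elt (mem_p_elt (pcore_pgroup _ _) Or) => t /eqP->.
have nZr : r \in G :\: 'Z(G).
  by rewrite inE Gr andbT; apply: contra ntr => Zr; rewrite defr /= coset_id.
apply/set1P/coset_id; apply: (subsetP (abelian_subcent1_TI nZx nZz neqC)).
rewrite inE Czm andbT.
by rewrite -(abelian_subcent1_eq nZx nZr Cxr) inE Gm; apply/cent1P.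
Qed.

Hypothesis eq_card_subcent1 : {in G :\: 'Z(G) &, forall x y, #|'C_G[x]| = #|'C_G[y]|}.

Lemma ltn_part_index_subcent1 p q x : x \in G :\: 'Z(G) -> prime p -> prime q -> p != q ->
    p %| #|'C_G[x] : 'Z(G)| -> q %| #|'C_G[x] : 'Z(G)| ->
  #|'C_G[x] : 'Z(G)|`_p < #|'C_G[x] : 'Z(G)|`_q.
Proof.
move=> nZx pr_p pr_q neq_pq p_dvd q_dvd; have [Gx _] := setDP nZx.
have pG : p %| #|G : 'Z(G)|.
  by rewrite -(Lagrange_index (subcent1_sub x G) (center_sub_subcent1 Gx)) dvdn_mull.
have [z [y [nZz nZy neqC nCzO]]] := exists_pcore_norm_subcent1 pr_p pG.
have eq_index w : w \in G :\: 'Z(G) -> #|'C_G[x] : 'Z(G)| = #|'C_G[w] : 'Z(G)|.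
  move=> nZw; have [Gw _] := setDP nZw.
  by rewrite -!divgS ?center_sub_subcent1 // (eq_card_subcent1 nZx nZw).
rewrite {1}(eq_index y nZy).
have q_part_gt1 : 1 < #|'C_G[x] : 'Z(G)|`_q.
  by rewrite p_part_gt1 mem_primes pr_q indexg_gt0.
rewrite -(ltn_predK q_part_gt1) ltnS dvdn_leq //; first by rewrite -subn1 subn_gt0.
by rewrite (eq_index z nZz) part_index_dvd_pred.
Qed.

End AbelianCentralizers.

Lemma induced_regular_prime_index_eq (gT : finGroupType) (G : {group gT}) (p q : nat) :
    induced_regular G -> prime p -> prime q ->
    p %| #|G : 'Z(G)| -> q %| #|G : 'Z(G)| ->
  p = q.
Proof.
move=> /induced_regularP eq_card_class pr_p pr_q p_dvd q_dvd; apply/eqP.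
apply: contraT => neq_pq.
have have_p := maximal_centers_have_prime eq_card_class pr_p p_dvd.
have have_q := maximal_centers_have_prime eq_card_class pr_q q_dvd.
have have_p' : maximal_centers_have G p^'.
  move=> y /have_q[e Ze qe]; exists e => //; apply: sub_p_elt qe => r /eqP->.
  by rewrite !inE eq_sym.
have maxG x : x \in G :\: 'Z(G) -> maximal_subcent1 G x.
  exact: all_maximal_subcent1 have_p have_p'.
have centerC x : x \in G :\: 'Z(G) -> 'Z('C_G[x]) = 'C_G[x].
  exact: center_subcent1_eq have_p have_p'.
have abC x : x \in G :\: 'Z(G) -> abelian 'C_G[x].
  by move/centerC <-; apply: center_abelian.
have eq_cardC : {in G :\: 'Z(G) &, forall x y, #|'C_G[x]| = #|'C_G[y]|}.
  move=> x y nZx nZy; rewrite -(centerC x nZx) -(centerC y nZy).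
  exact: eq_card_center_maximal (maxG x nZx) (maxG y nZy).
have [x nZx _] : exists2 x, x \in G :\: 'Z(G) & p.-elt x.
  exact/(dvdn_index_p_eltP pr_p (center_normal G)).
have [Gx _] := setDP nZx.
have dvdC r : prime r -> maximal_centers_have G r -> r %| #|'C_G[x] : 'Z(G)|.
  move=> pr_r /(_ x (maxG x nZx)) have_r; rewrite -(centerC x nZx).
  exact/(dvdn_index_p_eltP pr_r (center_normal_center_subcent1 Gx)).
have [p_dvdC q_dvdC] := (dvdC p pr_p have_p, dvdC q pr_q have_q).
have lt_part := ltn_part_index_subcent1 abC eq_cardC nZx.
have lt_pq := lt_part p q pr_p pr_q neq_pq p_dvdC q_dvdC.
have lt_qp : #|'C_G[x] : 'Z(G)|`_q < #|'C_G[x] : 'Z(G)|`_p.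
  by apply: lt_part; rewrite // eq_sym.
by have := ltn_trans lt_pq lt_qp; rewrite ltnn.
Qed.

Lemma induced_regular_quotient_center_pgroup (gT : finGroupType) (G : {group gT}) :
  induced_regular G -> exists2 p : nat, prime p & p.-group (G / 'Z(G)).
Proof.
move=> regG; rewrite /pgroup card_quotient ?gFnorm //.
have [-> | n_gt1] := eqVneq #|G : 'Z(G)| 1%N; first by exists 2.
have {}n_gt1 : 1 < #|G : 'Z(G)| by rewrite ltn_neqAle eq_sym n_gt1 indexg_gt0.
exists (pdiv #|G : 'Z(G)|); first exact: pdiv_prime.
apply/pnatP=> // q pr_q q_dvd; rewrite inE.
apply/eqP/(induced_regular_prime_index_eq regG) => //; first exact: pdiv_prime.
exact: pdiv_dvd.
Qed.

Theorem theorem3p9 (gT : finGroupType) (G : {group gT}) :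
  induced_regular G <->
  exists (hT aT : finGroupType) (H : {group hT}) (A : {group aT}) (p : nat),
    [/\ prime p, p.-group H, induced_regular H, abelian A
      & G \isog setX H A].
Proof.
split=> [regG | [hT [aT [H [A [p [_ _ regH abA isoG]]]]]]]; last first.
  exact/(isog_induced_regular isoG)/(setX_abelian_induced_regular H abA).
have [p pr_p pGZ] := induced_regular_quotient_center_pgroup regG.
have nilG : nilpotent G by rewrite -quotient_center_nil (pgroup_nil pGZ).
have abO : abelian 'O_p^'(G) := abelianS (pcoreC_sub_center pGZ) (center_abelian G).
have isoG : G \isog setX 'O_p(G) 'O_p^'(G).
  have defG := nilpotent_pcoreC p nilG.
  exact: isog_dprod defG (setX_dprod _ _) (isog_setX1 _ _) (isog_set1X _ _).
exists gT, gT, 'O_p(G)%G, 'O_p^'(G)%G, p; split; rewrite ?pcore_pgroup //.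
exact/(setX_abelian_induced_regular _ abO)/(isog_induced_regular isoG).
Qed.
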